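(* Let $n\ge 3$, consider the arc-reversal walk on the cycle graph $C_n$ with vertex set $\{0,\ldots,n-1\}$, where $i$ and $j$ are adjacent if and only if $i-j\equiv\pm1\pmod n$, and let $i$ be any vertex. The walk is $n$-periodic at vertex $i$. If $n=2m$, there is perfect state transfer from vertex $i$ to vertex $i+m \pmod n$ at time $m$. If $n=4\ell$, there is peak state transfer from $i$ to the vertices $i\pm\ell\pmod n$ at time $\ell$. There is no peak state transfer (at any time) between any of the other pairs of distinct vertices of $C_n$.
   Context: Arc-reversal walk: let $G=(V,E)$ be a finite simple graph without isolated vertices and $\mathcal{A}$ its set of arcs (ordered pairs $(u,v)$ with $uv\in E$; $u$ is the tail). Let $N\in\mathbb{R}^{\mathcal{A}\times V}$ with $N(a,v)=1/\sqrt{d(v)}$ if $v$ is the tail of $a$ and $0$ otherwise ($d(v)$ is the degree), and let $R$ be the permutation matrix on $\mathcal{A}$ swapping $(u,v)$ and $(v,u)$. The transition matrix is $U=R(2NN^T-I)$. Put $B_t=N^TU^tN$ for integers $t\ge0$, and $B=B_1=D^{-1/2}AD^{-1/2}$, where $A$ is the adjacency matrix and $D$ the diagonal degree matrix. Let $B=\sum_\theta\theta E_\theta$ be the spectral decomposition ($\theta$ over distinct eigenvalues, $E_\theta$ the orthogonal projection onto the $\theta$-eigenspace). For distinct vertices $u,v$ there is peak state transfer from $u$ to $v$ at time $t$ (a positive integer) if $|B_t(u,v)|=\sum_\theta|E_\theta(u,v)|$ and $E_\theta(u,v)\neq0$ for at least one $\theta$. There is perfect state transfer from $u$ to $v\neq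 u$ at time $t$ if $U^tN\mathbf{e}_u=\gamma N\mathbf{e}_v$ for some $\gamma\in\mathbb{C}$ with $|\gamma|=1$ (equivalently $|B_t(u,v)|=1$). The walk is periodic at $u$ if $U^tN\mathbf{e}_u=\gamma N\mathbf{e}_u$ for some integer $t>0$ and some $|\gamma|=1$; the smallest such $t$ is the period, and the walk is then called $t$-periodic at $u$. *)

(* Defs.v *)
From mathcomp Require Import all_boot all_order all_algebra.
Set Implicit Arguments.
Unset Strict Implicit.
Unset Printing Implicit Defensive.
Import Order.TTheory GRing.Theory Num.Theory.
Local Open Scope ring_scope.

Definition simple_graph (n : nat) (e : rel 'I_n) : Prop :=
  [/\ symmetric e, irreflexive e & forall v, exists w, e v w].

Definition degree (n : nat) (e : rel 'I_n) (v : 'I_n) : nat := #|[set w | e v w]|.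

Definition arc (n : nat) (e : rel 'I_n) := {a : 'I_n * 'I_n | e a.1 a.2}.

(* Matrix rows and columns are ordinals, so arcs are numbered by [enum_val]. *)
Notation arc_idx e := 'I_#|{: arc e}| (only parsing).
Definition tail (n : nat) (e : rel 'I_n) (a : arc_idx e) : 'I_n :=
  (val (enum_val a)).1.
Definition head (n : nat) (e : rel 'I_n) (a : arc_idx e) : 'I_n :=
  (val (enum_val a)).2.

Section Walk.
Variables (C : numClosedFieldType) (n : nat) (e : rel 'I_n).

Definition tail_mx : 'M[C]_(#|{: arc e}|, n) :=
  \matrix_(a, v) if tail a == v then (sqrtC (degree e v)%:R)^-1 else 0.

Definition reversal_mx : 'M[C]_#|{: arc e}| :=
  \matrix_(a, b) ((tail a == head b) && (head a == tail b))%:R.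

Definition transition_mx : 'M[C]_#|{: arc e}| :=
  reversal_mx *m (2%:R *: (tail_mx *m tail_mx^T) - 1%:M).

Definition vertex_walk_mx (t : nat) : 'M[C]_n :=
  tail_mx^T *m transition_mx ^+ t *m tail_mx.

Definition vertex_state (u : 'I_n) : 'cV[C]_#|{: arc e}| :=
  tail_mx *m delta_mx u 0.

Lemma sum_arc (V : nmodType) (F : 'I_n -> 'I_n -> V) :
  \sum_(a < #|{: arc e}|) F (tail a) (head a) = \sum_u \sum_(v | e u v) F u v.
Proof.
rewrite (reindex (@enum_rank {: arc e})) /=; last first.
  by exists enum_val => a _; rewrite ?enum_rankK ?enum_valK.
under eq_bigr do rewrite /tail /head enum_rankK.
rewrite pair_big_dep /= (reindex_omap (val : arc e -> _) insub) /=; last first.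
  by move=> p ep; rewrite insubT.
by apply: eq_bigl => a; rewrite (valP a) valK eqxx.
Qed.

Lemma tail_mx_orthonormal :
  simple_graph e -> tail_mx^T *m tail_mx = 1%:M.
Proof.
move=> [_ _ iso]; apply/matrixP => u v; rewrite !mxE.
under eq_bigr do rewrite !mxE.
rewrite (sum_arc (fun x _ => (if x == u then (sqrtC (degree e u)%:R)^-1 else 0)
  * (if x == v then (sqrtC (degree e v)%:R)^-1 else 0) : C)).
have [<-|uv] := eqVneq u v; last first.
  rewrite big1 // => x _; rewrite big1 // => y _.
  by case: (eqVneq x u) => [->|]; rewrite ?(negPf uv) ?mulr0 ?mul0r.
rewrite (bigD1 u) //= [X in _ + X]big1 ?addr0 => [|x /negPf xu]; last first.
  by rewrite big1 // => y _; rewrite xu mul0r.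
rewrite eqxx sumr_const -invfM -expr2 sqrtCK -[_ *+ _]mulr_natr.
have -> : #|e u| = degree e u by rewrite /degree; apply: eq_card => w; rewrite inE.
rewrite mulVf // pnatr_eq0 -lt0n; have [w uw] := iso u.
by apply/card_gt0P; exists w; rewrite inE.
Qed.

(* B_1 = D^(-1/2) A D^(-1/2). *)
Lemma vertex_walk_mx1E (u v : 'I_n) : simple_graph e ->
  vertex_walk_mx 1 u v =
    (sqrtC (degree e u)%:R)^-1 * (e u v)%:R * (sqrtC (degree e v)%:R)^-1.
Proof.
move=> sg; have [esym _ _] := sg; rewrite /vertex_walk_mx expr1 /transition_mx.
rewrite !mulmxA -mulmxA mulmxBl mul1mx -scalemxAl -[_ *m _ *m tail_mx]mulmxA.
rewrite tail_mx_orthonormal // mulmx1 scaler_nat mulr2n addrK.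
rewrite mxE; under eq_bigr => b _.
  rewrite mxE; under eq_bigr do rewrite !mxE.
  rewrite (sum_arc (fun x y => (if x == u then (sqrtC (degree e u)%:R)^-1 else 0)
    * ((x == head b) && (y == tail b))%:R : C)).
  rewrite mxE; over.
rewrite (sum_arc (fun x' y' => (\sum_x \sum_(y | e x y)
  (if x == u then (sqrtC (degree e u)%:R)^-1 else 0)
    * ((x == y') && (y == x'))%:R) *
  (if x' == v then (sqrtC (degree e v)%:R)^-1 else 0) : C)).
rewrite (bigD1 v) //= [X in _ + X]big1 ?addr0 => [|x /negPf xv]; last first.
  by rewrite big1 // => y _; rewrite xv mulr0.
rewrite eqxx -mulr_suml; congr (_ * _).
under eq_bigr => y' _.
  rewrite (bigD1 u) //= [X in _ + X]big1 ?addr0 => [|x /negPf xu]; last first.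
    by rewrite big1 // => y _; rewrite xu mul0r.
  rewrite eqxx -mulr_sumr; over.
rewrite -mulr_sumr; congr (_ * _).
rewrite exchange_big /= big_mkcond (bigD1 v) //=.
rewrite [X in _ + X]big1 ?addr0 => [|x /negPf xv]; last first.
  by case: ifP => // _; rewrite big1 // => y _; rewrite xv andbF.
case uv: (e u v); last by [].
rewrite (bigD1 u) ?[e v u]esym //= !eqxx big1 ?addr0 // => y /andP[_ /negPf yu].
by rewrite eq_sym yu.
Qed.

End Walk.

Section Spectrum.
Variables (C : numClosedFieldType) (n : nat).
Implicit Type M : 'M[C]_n.

Definition spectrum M : seq C :=
  undup (sval (closed_field_poly_normal (char_poly M))).

Lemma spectrum_uniq M : uniq (spectrum M).
Proof. exact: undup_uniq. Qed.

Lemma mem_spectrum M (theta : C) : (theta \in spectrum M) = eigenvalue M theta.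
Proof.
rewrite mem_undup eigenvalue_root_char.
case: closed_field_poly_normal => r /= ->.
by rewrite (monicP (char_poly_monic M)) scale1r root_prod_XsubC.
Qed.

(* [eigenspace] and [proj_ortho] work with row vectors; the transpositions turn
   this into the projection of column vectors onto {x | M *m x = theta *: x}. *)
Definition eigenprojection M (theta : C) : 'M[C]_n :=
  (proj_ortho (eigenspace M^T theta))^T.

End Spectrum.

Section StateTransfer.
Variables (C : numClosedFieldType) (n : nat) (e : rel 'I_n).

Let B : 'M[C]_n := vertex_walk_mx C e 1.

Definition peak_state_transfer (u v : 'I_n) (t : nat) : Prop :=
  [/\ u != v, (0 < t)%N,
      `|vertex_walk_mx C e t u v| =
        \sum_(theta <- spectrum B) `|eigenprojection B theta u v|
    & exists2 theta, theta \in spectrum B & eigenprojection B theta u v != 0].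

Definition maps_state (u v : 'I_n) (t : nat) : Prop :=
  exists2 gamma : C, `|gamma| = 1 &
    transition_mx C e ^+ t *m vertex_state C e u = gamma *: vertex_state C e v.

Definition perfect_state_transfer (u v : 'I_n) (t : nat) : Prop :=
  u != v /\ maps_state u v t.

Definition periodic_at (t : nat) (u : 'I_n) : Prop :=
  [/\ (0 < t)%N, maps_state u u t
    & forall s : nat, (0 < s)%N -> maps_state u u s -> (t <= s)%N].

End StateTransfer.

Definition cycle_adj (n : nat) : rel 'I_n :=
  fun i j => (i == j + 1 %[mod n])%N || (j == i + 1 %[mod n])%N.

Lemma cycle_simple (n : nat) : (3 <= n)%N -> simple_graph (@cycle_adj n).
Proof.
move=> n3; split.
- by move=> i j; rewrite /cycle_adj orbC.
- move=> i; rewrite /cycle_adj orbb -[X in X == _ %[mod n]]addn0 eqn_modDl.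
  by rewrite !modn_small //; case: n n3 i => [|[]].
- move=> v; have n0 : (0 < n)%N by case: n n3 v.
  exists (Ordinal (ltn_pmod (v + 1) n0)).
  by rewrite /cycle_adj /= modn_mod eqxx orbT.
Qed.

(* Main.v *)
Require Import Defs.
From mathcomp Require Import all_boot all_order all_algebra.
From mathcomp Require Import reals complex.
From mathcomp Require Import perm zify ring.
Set Implicit Arguments.
Unset Strict Implicit.
Unset Printing Implicit Defensive.
Import Order.TTheory GRing.Theory Num.Theory.
Local Open Scope ring_scope.
Local Open Scope sesquilinear_scope.

(** Write B_t for [vertex_walk_mx t], N for [tail_mx], R for [reversal_mx] and U
    for [transition_mx], and index the vertices of C_n by Z/n.

    On any graph without isolated vertices, R and 2 N N^T - 1 are involutions and
    N^T N = 1, so B_(t+2) = 2 B_1 B_(t+1) - B_t ([vertex_walk_mx_rec]): B_t is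
    the t-th Chebyshev polynomial in B_1.  On the cycle B_1 averages over the
    translations by 1 and -1, hence B_t averages over those by t and -t:
    B_t(i, j) = ([i - j = t] + [i - j = - t]) / 2 ([cycle_walk_mxE]).  Since U
    is real orthogonal, B_t(v, u) = 1 forces U^t N e_u = N e_v, the difference
    having norm 0 ([maps_stateP]); conversely a transfer from u to v at time t
    gives |B_t(v, u)| = 1 ([maps_state_norm]).  The period n and the perfect
    state transfer to the antipode follow.

    For peak state transfer no eigenvalue is computed.  Let E be the projection
    onto an eigenspace of B_1.  It commutes with the reflections k |-> s - k,
    so E(i, j) = f(i - j) for an even function f; as E is an orthogonal
    projection, f is real and |f| <= f(0).  As B_d E is a scalar multiple of E,
    f(d)^2 = f(0) (f(0) + f(2d)) / 2 ([cycle_proj_double]), the double-angle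
    formula for f / f(0).  From this identity at d and at 2d,
    |f(d)| >= (f(0) + f(2d)) / 2, with equality iff f(4d) = f(0)
    ([doubling_norm_ge]).  The projections sum to the identity, so if 2d is not 0
    then summing over the eigenspaces gives sum |f(d)| >= 1/2, with equality iff
    4d = 0 ([sum_cycle_proj_norm_leif]).  Finally |B_t(i, j)| is 0 or 1/2 when
    2(i - j) is not 0, so peak state transfer between such vertices requires
    4(i - j) = 0, and then it does occur when i - j is t or - t. *)

(** * Orthogonal eigenprojections of Hermitian matrices *)

Section HermitianSpectrum.
Variables (C : numClosedFieldType) (n : nat).
Implicit Types M Q : 'M[C]_n.

Lemma hermsym_trmx M : M \is hermsymmx -> M^T \is hermsymmx.
Proof.
move=> /is_hermitianmxP; rewrite expr0 scale1r => MH.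
by apply/is_hermitianmxP; rewrite expr0 scale1r [in LHS]MH map_trmx !trmxK.
Qed.

(** In an orthonormal eigenbasis, the columns of [Q], the matrix [M] and all its
    eigenprojections are diagonal. *)
Lemma hermitian_diagonalization M : M \is hermsymmx ->
  exists Q (d : 'rV[C]_n), [/\ Q *m Q^t* = 1%:M, Q^t* *m Q = 1%:M,
    M = Q *m diag_mx d *m Q^t*
    & forall theta, eigenprojection M theta =
        Q *m diag_mx (\row_k (d 0 k == theta)%:R) *m Q^t*].
Proof.
move=> /hermsym_trmx MH; have := MH => /hermitian_normalmx/orthomx_spectralP.
have Preal := hermitian_spectral_diag_real MH.
have := spectral_unitarymx M^T; move: (spectralmx _) (spectral_diag _) Preal.
move=> P d dreal Pu; rewrite invmx_unitary // => MTE.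
have PP : P *m P^t* = 1%:M by apply/unitarymxP.
have PP' : P^t* *m P = 1%:M by apply: mulmx1C.
have PTE : (P^T)^t* = (P^t*)^T by rewrite map_trmx.
(* Eigenspaces are spaces of row vectors: the rows of P are eigenvectors of
   M^T, so the columns of P^T are eigenvectors of M. *)
exists P^T, d; rewrite PTE; split.
- by rewrite -trmx_mul PP' trmx1.
- by rewrite -trmx_mul PP trmx1.
- by rewrite -[M]trmxK MTE !trmx_mul tr_diag_mx mulmxA.
move=> theta; rewrite /eigenprojection; set V := eigenspace _ _.
suff PF : P *m proj_ortho V = diag_mx (\row_k (d 0 k == theta)%:R) *m P.
  by rewrite -[proj_ortho V]mul1mx -PP' -(mulmxA _ P) PF !trmx_mul tr_diag_mx.
have PM : P *m M^T = diag_mx d *m P by rewrite MTE !mulmxA PP mul1mx.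
have rPM k : row k P *m M^T = d 0 k *: row k P.
  by rewrite -row_mul PM mul_diag_mx; apply/rowP=> j; rewrite !mxE.
apply/row_matrixP=> k; rewrite row_mul mul_diag_mx.
have -> : row k (\matrix_(i, j) ((\row_k0 (d 0 k0 == theta)%:R) 0 i * P i j)) =
    (d 0 k == theta)%:R *: row k P by apply/rowP=> j; rewrite !mxE.
have [dk|dk] := eqVneq (d 0 k) theta.
  by rewrite scale1r; apply: proj_ortho_id; apply/eigenspaceP; rewrite rPM dk.
rewrite scale0r; apply: proj_ortho_0; apply/orthomx1P.
have VM : V *m M^T = theta *: V by apply/eigenspaceP.
have MTH : M^T = (M^T)^t*.
  by have /is_hermitianmxP := MH; rewrite expr0 scale1r.
(* Rows of P and V for the eigenvalues d 0 k and theta are orthogonal, as d 0 k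
   is real and hence also differs from the conjugate of theta. *)
have : d 0 k *: (row k P *m V^t*) = theta^* *: (row k P *m V^t*).
  rewrite [LHS]scalemxAl -rPM -mulmxA [in LHS]MTH -map_mxM -trmx_mul VM.
  by rewrite linearZ map_mxZ -scalemxAr.
move=> /eqP; rewrite -subr_eq0 -scalerBl scaler_eq0 subr_eq0 => /orP[|/eqP //].
have /mxOverP/(_ 0 k)/CrealP dk' := dreal.
by rewrite -dk' (can_eq (@conjCK _)) (negPf dk).
Qed.

Lemma mem_hermitian_spectrum M Q (d : 'rV[C]_n) k :
  Q *m Q^t* = 1%:M -> Q^t* *m Q = 1%:M -> M = Q *m diag_mx d *m Q^t* ->
  d 0 k \in spectrum M.
Proof.
move=> QQ QQ' ->; rewrite mem_spectrum; apply/eigenvalueP.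
exists (row k (Q^t*)).
  rewrite -row_mul !mulmxA QQ' mul1mx row_mul row_diag_mx -scalemxAl.
  by rewrite -rowE.
apply/eqP => /(congr1 (mulmxr Q)); rewrite /= mul0mx -row_mul QQ'.
by move=> /rowP/(_ k)/eqP; rewrite !mxE eqxx oner_eq0.
Qed.

Section Projections.
Variables (M : 'M[C]_n) (MH : M \is hermsymmx).
Local Notation E := (eigenprojection M).

Lemma eigenprojection_mull theta : M *m E theta = theta *: E theta.
Proof.
have [Q [d [_ QQ' ME ->]]] := hermitian_diagonalization MH.
rewrite {1}ME !mulmxA -(mulmxA _ _ Q) QQ' mulmx1 -(mulmxA Q) mulmx_diag.
rewrite scalemxAl scalemxAr -linearZ; congr (_ *m diag_mx _ *m _).
apply/rowP => k; rewrite !mxE.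
by case: eqP => [->|_]; rewrite ?mulr0.
Qed.

Lemma eigenprojection_mulr theta : E theta *m M = theta *: E theta.
Proof.
have [Q [d [_ QQ' ME ->]]] := hermitian_diagonalization MH.
rewrite {1}ME !mulmxA -(mulmxA _ _ Q) QQ' mulmx1 -(mulmxA Q) mulmx_diag.
rewrite scalemxAl scalemxAr -linearZ; congr (_ *m diag_mx _ *m _).
apply/rowP => k; rewrite !mxE.
by case: eqP => [->|_]; rewrite ?mulr0 ?mul0r // mulrC.
Qed.

Lemma eigenprojection_idem theta : E theta *m E theta = E theta.
Proof.
have [Q [d [_ QQ' ME ->]]] := hermitian_diagonalization MH.
rewrite !mulmxA -(mulmxA _ _ Q) QQ' mulmx1 -(mulmxA Q) mulmx_diag.
congr (_ *m diag_mx _ *m _); apply/rowP => k; rewrite !mxE.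
by case: eqP; rewrite ?mulr0 ?mulr1.
Qed.

Lemma eigenprojection_herm theta : (E theta)^t* = E theta.
Proof.
have [Q [d [_ _ _ ->]]] := hermitian_diagonalization MH.
rewrite !trmx_mul !map_mxM tr_diag_mx map_trmx trmxK -map_mx_comp.
rewrite (map_mx_id (@conjCK _)) map_diag_mx !mulmxA.
congr (_ *m diag_mx _ *m _); apply/rowP => k; rewrite !mxE.
exact: conjC_nat.
Qed.

Lemma sum_eigenprojection : \sum_(theta <- spectrum M) E theta = 1%:M.
Proof.
have [Q [d [QQ QQ' ME EE]]] := hermitian_diagonalization MH.
under eq_bigr do rewrite EE.
rewrite -mulmx_suml -mulmx_sumr -linear_sum /=.
transitivity (Q *m 1%:M *m Q^t*); last by rewrite mulmx1.
congr (_ *m _ *m _); rewrite -diag_const_mx; congr diag_mx.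
apply/rowP => k; rewrite summxE mxE.
rewrite (bigD1_seq (d 0 k)) ?spectrum_uniq ?(mem_hermitian_spectrum k QQ) //=.
rewrite mxE eqxx big1 ?addr0 // => theta /negPf; rewrite mxE eq_sym.
by move=> ->.
Qed.

(** [E theta] commutes with the commutant of [M], since [E t *m Q *m E u]
    vanishes for [t != u]. *)
Lemma eigenprojection_comm Q theta : theta \in spectrum M ->
  Q *m M = M *m Q -> Q *m E theta = E theta *m Q.
Proof.
move=> thS QM.
have orth t u : t != u -> E t *m Q *m E u = 0.
  move=> tu; have : t *: (E t *m Q *m E u) = u *: (E t *m Q *m E u).
    rewrite scalemxAl scalemxAl -eigenprojection_mulr scalemxAr.
    by rewrite -eigenprojection_mull -!mulmxA (mulmxA M) (mulmxA Q) QM.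
  move=> /eqP; rewrite -subr_eq0 -scalerBl scaler_eq0 subr_eq0 (negPf tu).
  by move=> /eqP.
transitivity (E theta *m Q *m E theta).
  rewrite -[in LHS](mul1mx Q) -sum_eigenprojection !mulmx_suml.
  rewrite (bigD1_seq theta) ?spectrum_uniq //= big1 ?addr0 // => t.
  exact: orth.
rewrite -[in RHS](mulmx1 Q) -sum_eigenprojection !mulmx_sumr.
rewrite (bigD1_seq theta) ?spectrum_uniq //= big1 ?addr0 ?mulmxA // => t.
by rewrite mulmxA eq_sym; apply: orth.
Qed.

(** Permutation symmetries of [M], such as those induced by graph automorphisms,
    are symmetries of its eigenprojections. *)
Lemma eigenprojection_perm (s : 'S_n) theta : theta \in spectrum M ->
    (forall i j, M (s i) (s j) = M i j) ->
  forall i j, E theta (s i) (s j) = E theta i j.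
Proof.
move=> thS Ms i j; have sM : perm_mx s *m M = M *m perm_mx s.
  rewrite -[s in RHS]invgK -col_permE -row_permE; apply/matrixP => a b.
  by rewrite !mxE -[in LHS](permKV s b) Ms.
have := eigenprojection_comm thS sM.
rewrite -[s in RHS]invgK -col_permE -row_permE => /matrixP/(_ i (s j)).
by rewrite !mxE permK.
Qed.

End Projections.

End HermitianSpectrum.

(** * The arc-reversal walk on an arbitrary graph *)

Section ArcReversalWalk.
Variables (C : numClosedFieldType) (n : nat) (e : rel 'I_n).
Hypothesis sg : simple_graph e.
Local Notation N := (tail_mx C e).
(* The ends of an arc, not the operations on sequences of the same name. *)
Local Notation tail := (@Defs.tail n e).
Local Notation head := (@Defs.head n e).
Local Notation R := (reversal_mx C e).
Local Notation U := (transition_mx C e).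
Local Notation B := (vertex_walk_mx C e).

Lemma arc_adj (a : 'I_#|{: Defs.arc e}|) : e (tail a) (head a).
Proof. exact: (valP (enum_val a)). Qed.

Lemma arc_eqE (a b : 'I_#|{: Defs.arc e}|) :
  (a == b) = (tail a == tail b) && (head a == head b).
Proof.
apply/eqP/andP => [->|[/eqP tab /eqP hab]]; first by rewrite !eqxx.
apply/enum_val_inj/val_inj; move: tab hab; rewrite /tail /head.
by case: (val _) (val _) => [? ?] [? ?] /= -> ->.
Qed.

Lemma reversal_mx_tr : R^T = R.
Proof.
by apply/matrixP => a b; rewrite !mxE [tail a == _]eq_sym [head a == _]eq_sym andbC.
Qed.

Lemma reversal_mx_sq : R *m R = 1%:M.
Proof.
have [esym _ _] := sg; apply/matrixP => a b; rewrite !mxE.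
under eq_bigr do rewrite !mxE -natrM mulnb.
rewrite (sum_arc e (fun x y => ((tail a == y) && (head a == x) &&
  ((x == head b) && (y == tail b)))%:R : C)) /=.
under eq_bigr do under eq_bigr do rewrite -?andbA.
rewrite (bigD1 (head a)) //= [X in _ + X]big1 ?addr0; last first.
  move=> x /negPf xa; rewrite big1 // => y _.
  by rewrite [head a == x]eq_sym xa andbF.
have aa : e (head a) (tail a) by rewrite esym; apply: arc_adj.
rewrite (bigD1 (tail a) aa) /= big1 ?addr0; last first.
  by move=> y /andP[_ /negPf ya]; rewrite eq_sym ya.
by rewrite !eqxx /= andbC -arc_eqE.
Qed.

Lemma coin_mx_sq (K := 2%:R *: (N *m N^T) - 1%:M) : K *m K = 1%:M.
Proof.
rewrite /K mulmxBl mul1mx mulmxBr mulmx1 -!scalemxAl -!scalemxAr.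
rewrite -mulmxA (mulmxA N^T) tail_mx_orthonormal // mul1mx.
set Z := N *m N^T; rewrite (_ : 2%:R *: (2%:R *: Z) = 2%:R *: Z + 2%:R *: Z).
  by rewrite addrK opprB addrC subrK.
by rewrite scalerA -scalerDl; congr (_ *: _); rewrite mulr_natr.
Qed.

Lemma transition_mx_unitary : U^T *m U = 1%:M.
Proof.
rewrite /transition_mx trmx_mul reversal_mx_tr mulmxA -[_ *m R *m R]mulmxA.
rewrite reversal_mx_sq mulmx1.
set K := _ - _; suff -> : K^T = K by apply: coin_mx_sq.
by rewrite /K linearB linearZ /= trmx_mul trmxK trmx1.
Qed.

Lemma transition_mx_exp_unitary t : (U ^+ t)^T *m U ^+ t = 1%:M.
Proof.
elim: t => [|t IH]; first by rewrite expr0 trmx1 mulmx1.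
rewrite exprS trmx_mul mulmxA -[_ *m U^T *m U]mulmxA transition_mx_unitary.
by rewrite mulmx1.
Qed.

Lemma tail_mx_real : N \is a mxOver Num.real.
Proof.
apply/mxOverP => a v; rewrite mxE; case: ifP => _; last exact: real0.
by rewrite realV ger0_real // sqrtC_ge0 ler0n.
Qed.

Lemma transition_mx_real : U \is a mxOver Num.real.
Proof.
rewrite /transition_mx.
apply: mxOverM; first by apply/mxOverP => a b; rewrite mxE realn.
apply: rpredB; last by apply: mxOver_scalar; rewrite ?real0 ?real1.
apply: mxOverZ; first exact: realn.
apply: mxOverM; first exact: tail_mx_real.
by apply/mxOverP => a b; rewrite mxE; apply: (mxOverP tail_mx_real).
Qed.

Lemma vertex_walk_mx0 : B 0 = 1%:M.
Proof. by rewrite /vertex_walk_mx expr0 mulmx1 tail_mx_orthonormal. Qed.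

Lemma vertex_walk_mx1 : B 1 = N^T *m R *m N.
Proof.
rewrite /vertex_walk_mx expr1 /transition_mx !mulmxA -mulmxA mulmxBl mul1mx.
rewrite -scalemxAl -[N *m _ *m N]mulmxA tail_mx_orthonormal // mulmx1.
by rewrite scaler_nat mulr2n addrK.
Qed.

(** The Chebyshev recurrence.  It holds because
    [N^T *m U = 2%:R *: (B 1 *m N^T) - N^T *m R], while [N^T *m R] is [N^T] times
    the inverse of [U]. *)
Lemma vertex_walk_mx_rec t : B t.+2 = 2%:R *: (B 1 *m B t.+1) - B t.
Proof.
have NTU : N^T *m U = 2%:R *: (B 1 *m N^T) - N^T *m R.
  rewrite vertex_walk_mx1 /transition_mx mulmxA mulmxBr mulmx1 -scalemxAr.
  by rewrite !mulmxA.
have NTUU : N^T *m (U *m U) = 2%:R *: (B 1 *m (N^T *m U)) - N^T.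
  rewrite [LHS]mulmxA {1}NTU mulmxBl -scalemxAl -(mulmxA (B 1)); congr (_ - _).
  rewrite /transition_mx !mulmxA -[_ *m R *m R]mulmxA reversal_mx_sq mulmx1.
  rewrite mulmxBr mulmx1 -scalemxAr mulmxA tail_mx_orthonormal // mul1mx.
  by rewrite scaler_nat mulr2n addrK.
have U2 : U ^+ t.+2 = U *m U *m U ^+ t by rewrite !exprS mulrA.
have U1 : U ^+ t.+1 = U *m U ^+ t by rewrite exprS.
rewrite [LHS]/vertex_walk_mx U2 mulmxA NTUU [B t.+1]/vertex_walk_mx U1.
by rewrite !mulmxBl -!scalemxAl !mulmxA.
Qed.

Lemma vertex_walk_mx_eigen m (X : 'M[C]_(n, m)) theta t :
  B 1 *m X = theta *: X -> exists c, B t *m X = c *: X.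
Proof.
move=> BX.
have [] // : (exists c, B t *m X = c *: X) /\ (exists c, B t.+1 *m X = c *: X).
elim: t => [|t [[c ct] [c' ct']]].
  by split; [exists 1; rewrite vertex_walk_mx0 mul1mx scale1r | exists theta].
split; first by exists c'.
exists (2%:R * (c' * theta) - c).
rewrite vertex_walk_mx_rec mulmxBl -scalemxAl -mulmxA ct' -scalemxAr BX ct.
by rewrite !scalerA -scalerBl mulrA.
Qed.

(** The states are real unit vectors and [U] is orthogonal, so this is the
    equality case of the Cauchy-Schwarz inequality. *)
Lemma maps_stateP u v t : B t v u = 1 -> maps_state C e u v t.
Proof.
move=> Bvu; exists 1; rewrite ?normr1 // scale1r; apply/eqP; rewrite -subr_eq0.
(* x is real and satisfies x^T x = 1 - 1 - (1 - 1) = 0, so it vanishes. *)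
set x := _ - _.
have xreal : x \is a mxOver Num.real.
  have sreal w : vertex_state C e w \is a mxOver Num.real.
    apply: mxOverM; first exact: tail_mx_real.
    by apply/mxOverP => a b; rewrite mxE realn.
  apply/mxOverP => a b; rewrite /x mxE [X in _ + X]mxE.
  apply: realB; apply/mxOverP; last exact: sreal.
  apply: mxOverM => //; clear x; elim: t {Bvu} => [|t IH].
    by rewrite expr0; apply: mxOver_scalar; rewrite ?real0 ?real1.
  by rewrite exprS; apply: mxOverM; rewrite ?transition_mx_real.
have sE w : vertex_state C e w = N *m delta_mx w 0 by [].
have dE (A : 'M[C]_n) w z : (delta_mx w 0 : 'cV_n)^T *m A *m delta_mx z 0
    = (A w z)%:M.
  rewrite trmx_delta -rowE -colE; apply/matrixP => i j.
  by rewrite !ord1 !mxE eqxx mulr1n.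
have UN t' w : U ^+ t' *m vertex_state C e w = U ^+ t' *m N *m delta_mx w 0.
  by rewrite sE mulmxA.
have xx : x^T *m x = 0.
  set y := U ^+ t *m vertex_state C e u; set z := vertex_state C e v.
  have yy : y^T *m y = 1%:M.
    rewrite /y UN !trmx_mul !mulmxA -[_ *m (U ^+ t)^T *m _]mulmxA.
    rewrite transition_mx_exp_unitary mulmx1 -[_ *m N^T *m N]mulmxA.
    by rewrite tail_mx_orthonormal // dE mxE eqxx.
  have zz : z^T *m z = 1%:M.
    rewrite /z sE trmx_mul !mulmxA -[_ *m N^T *m N]mulmxA.
    by rewrite tail_mx_orthonormal // dE mxE eqxx.
  have zy : z^T *m y = 1%:M.
    by rewrite -Bvu -dE /z /y UN sE trmx_mul /vertex_walk_mx !mulmxA.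
  have yz : y^T *m z = 1%:M by rewrite -[LHS]trmxK trmx_mul trmxK zy trmx1.
  rewrite /x -/y -/z mulmxBr linearB /= !mulmxBl.
  by rewrite yy zy yz zz !subrr.
clearbody x; apply/eqP/matrixP => a b; rewrite ord1 [RHS]mxE.
have /matrixP/(_ 0 0)/eqP := xx; rewrite !mxE psumr_eq0.
  move=> /allP/(_ a (mem_index_enum _)) /=; rewrite mxE mulf_eq0 orbb.
  by move=> /eqP.
by move=> c _; rewrite mxE -expr2 real_exprn_even_ge0 //; apply: (mxOverP xreal).
Qed.

Lemma maps_state_norm u v t : maps_state C e u v t -> `|B t v u| = 1.
Proof.
case=> g g1 /(congr1 (mulmx N^T)) /(congr1 (fun A : 'cV_n => A v 0)).
rewrite -scalemxAr /vertex_state !mulmxA tail_mx_orthonormal // mul1mx.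
by rewrite -/(B t) -colE !mxE !eqxx mulr1 => ->.
Qed.

End ArcReversalWalk.

(** * A doubling inequality *)

(** With [f = w cos x], [f2 = w cos 2x] and [f4 = w cos 4x], this is
    [cos^2 x <= |cos x|], with equality iff [cos 4x = 1].  The bounds on [f2]
    and [f4] only serve when [w = 0]. *)
Lemma doubling_norm_ge (C : numFieldType) (w f f2 f4 : C) :
    f \is Num.real -> `|f| <= w -> `|f2| <= w -> `|f4| <= w ->
    f ^+ 2 = w * ((w + f2) / 2%:R) -> f2 ^+ 2 = w * ((w + f4) / 2%:R) ->
  (w + f2) / 2%:R <= `|f| ?= iff (f4 == w).
Proof.
move=> freal fw f2w f4w fE f2E; have w0 : 0 <= w := le_trans (normr_ge0 f) fw.
have [wz|wn0] := eqVneq w 0.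
  move: fw f2w f4w; rewrite wz !normr_le0 => /eqP-> /eqP-> /eqP->.
  by rewrite addr0 mul0r normr0 eqxx; apply/leif_refl.
(* The two sides differ by a (w - a) / w, and f4 - w is 8 / w^3 times
   a^2 (a - w) (a + w): both vanish exactly when a is 0 or w. *)
set a : C := `|f|; have a0 : 0 <= a by apply: normr_ge0.
have wgt0 : 0 < w by rewrite lt_def wn0.
have aE : a ^+ 2 = w * ((w + f2) / 2%:R) by rewrite /a real_normK.
have sE : (w + f2) / 2%:R = a ^+ 2 / w by rewrite aE [RHS]mulrC mulKf.
have gap : a - (w + f2) / 2%:R = a * (w - a) / w by rewrite sE; field.
have f2D : f2 = 2%:R * a ^+ 2 / w - w by rewrite aE; field.
have f4E : f4 - w = 8%:R * a ^+ 2 * (a - w) * (a + w) / w ^+ 3.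
  have -> : f4 = 2%:R * f2 ^+ 2 / w - w by rewrite f2E; field.
  by rewrite f2D; field.
split.
  by rewrite -subr_ge0 gap mulr_ge0 ?invr_ge0 // mulr_ge0 // subr_ge0.
rewrite eq_sym -subr_eq0 gap -[RHS]subr_eq0 f4E !mulf_eq0 !invr_eq0.
rewrite expf_eq0 pnatr_eq0 orbb [a + w == 0]paddr_eq0 // (negPf wn0).
by rewrite !andbF !orbF !subr_eq0 [w == a]eq_sym.
Qed.

(** * The cycle *)

Section Cycle.
Variables (C : numClosedFieldType) (p : nat).
Local Notation n := p.+3.
Local Notation V := 'I_n.
Local Notation Cn := (@cycle_adj n).
Local Notation B := (vertex_walk_mx C Cn).
Implicit Types i j a b d s : V.

(** Adjacency in terms of the addition of ['I_n], that is modulo [n]. *)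
Lemma cycle_adjE i j : Cn i j = (i == j + 1) || (j == i + 1).
Proof.
have succE a b : (a == b + 1 %[mod n])%N = (a == b + 1).
  by rewrite (modn_small (ltn_ord a)) -val_eqE.
by rewrite /cycle_adj !succE.
Qed.

(** As [n >= 3], the two neighbours [i - 1] and [i + 1] of [i] are distinct. *)
Lemma two_neq0 : (1 + 1 : V) != 0.
Proof. by []. Qed.

Lemma cycle_degree i : degree Cn i = 2%N.
Proof.
rewrite /degree; have -> : [set k | Cn i k] = [set i - 1; i + 1].
  by apply/setP => k; rewrite !inE cycle_adjE -subr_eq [_ == k]eq_sym.
rewrite cards2; case: eqVneq => //.
move/eqP; rewrite eq_sym -subr_eq0 (_ : _ - _ = 1 + 1); last by ring.
by rewrite (negPf two_neq0).
Qed.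

Let sg : simple_graph Cn := @cycle_simple n isT.

Lemma cycle_walk_mx1 i j :
  B 1 i j = ((i == j + 1)%:R + (i == j - 1)%:R) / 2%:R.
Proof.
rewrite vertex_walk_mx1E // !cycle_degree cycle_adjE mulrAC -invfM -expr2 sqrtCK.
rewrite mulrC; congr (_ / _).
rewrite -[j == i + 1]subr_eq [j - 1 == i]eq_sym.
have [->|_] := eqVneq i (j + 1); last by rewrite add0r.
rewrite -subr_eq0 (_ : _ - _ = 1 + 1) ?(negPf two_neq0) ?addr0 //.
by ring.
Qed.

(** Left multiplication by the average of two opposite translations. *)
Lemma shift_average_mulmx (M : 'M[C]_n) d m (A : 'M[C]_(n, m)) i (j : 'I_m) :
    (forall a b, M a b = ((a - b == d)%:R + (a - b == - d)%:R) / 2%:R) ->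
  (M *m A) i j = (A (i - d) j + A (i + d) j) / 2%:R.
Proof.
move=> ME; rewrite mxE (eq_bigr (fun l => ((l == i - d)%:R * A l j
  + (l == i + d)%:R * A l j) / 2%:R)) => [|l _].
  rewrite -mulr_suml big_split /= (bigD1 (i - d)) //= eqxx mul1r.
  rewrite big1 ?addr0 => [|l /negPf->]; last by rewrite mul0r.
  rewrite (bigD1 (i + d)) //= eqxx mul1r big1 ?addr0 // => l /negPf->.
  by rewrite mul0r.
rewrite ME -[i - l == d]subr_eq0 -[i - l == - d]subr_eq0 opprK.
rewrite -[l == i - d]subr_eq0 -[l == i + d]subr_eq0.
rewrite -[l - (i - d) == 0]oppr_eq0 -[l - (i + d) == 0]oppr_eq0 !opprB.
by rewrite [i - d - l]addrAC [i + d - l]addrAC mulrAC mulrDl.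
Qed.

Lemma cycle_walk_mxE t i j :
  B t i j = ((i - j == t%:R)%:R + (i - j == - t%:R)%:R) / 2%:R.
Proof.
have [] // : (forall i, B t i j =
    ((i - j == t%:R)%:R + (i - j == - t%:R)%:R) / 2%:R) /\
  (forall i, B t.+1 i j =
    ((i - j == t.+1%:R)%:R + (i - j == - t.+1%:R)%:R) / 2%:R).
elim: t i => [|t IH] i.
  split=> k.
    rewrite vertex_walk_mx0 // mxE oppr0 subr_eq0 -natrD addnn -mul2n natrM.
    by rewrite mulrC mulKf ?pnatr_eq0.
  by rewrite cycle_walk_mx1 !subr_eq [1 + j]addrC [- 1 + j]addrC.
have [IHt IHt1] := IH i; split=> // k.
have BB : (B 1 *m B t.+1) k j = (B t.+1 (k - 1) j + B t.+1 (k + 1) j) / 2%:R.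
  apply: shift_average_mulmx => x y.
  by rewrite cycle_walk_mx1 !subr_eq [1 + y]addrC [- 1 + y]addrC.
rewrite vertex_walk_mx_rec // [LHS]mxE [X in _ + X]mxE mxE BB !IHt1 IHt.
have e1 : (k - 1 - j == t.+1%:R) = (k - j == t.+2%:R).
  by rewrite addrAC subr_eq [in RHS]mulrSr.
have e2 : (k - 1 - j == - t.+1%:R) = (k - j == - t%:R).
  by rewrite addrAC subr_eq mulrSr opprD addrNK.
have e3 : (k + 1 - j == t.+1%:R) = (k - j == t%:R).
  by rewrite addrAC mulrSr (inj_eq (addIr 1)).
have e4 : (k + 1 - j == - t.+1%:R) = (k - j == - t.+2%:R).
  by rewrite addrAC -(inj_eq (addIr (-1))) addrK [in RHS]mulrSr opprD.
by rewrite e1 e2 e3 e4; field.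
Qed.

Lemma cycle_walk_mx1_sym i j : B 1 i j = B 1 j i.
Proof. by rewrite !cycle_walk_mxE -!eqr_oppLR !opprB addrC. Qed.

Lemma cycle_walk_mulmx t m (A : 'M[C]_(n, m)) i (j : 'I_m) :
  (B t *m A) i j = (A (i - t%:R) j + A (i + t%:R) j) / 2%:R.
Proof. exact/shift_average_mulmx/cycle_walk_mxE. Qed.

Lemma cycle_walk_mx_herm : B 1 \is hermsymmx.
Proof.
apply: realsym_hermsym.
  apply/is_hermitianmxP; rewrite expr0 scale1r map_mx_id //.
  by apply/matrixP => i j; rewrite [RHS]mxE cycle_walk_mx1_sym.
apply/mxOverP => i j; rewrite cycle_walk_mxE.
by rewrite realM ?realV ?realn // realD ?realn.
Qed.

Section Projection.
Variable theta : C.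
Hypothesis thetaS : theta \in spectrum (B 1).
Local Notation E := (eigenprojection (B 1) theta).

Lemma cycle_proj_refl s i j : E (s - i) (s - j) = E i j.
Proof.
have sinj : injective (fun k => s - k) by move=> x y /addrI/oppr_inj.
have := eigenprojection_perm cycle_walk_mx_herm (s := perm sinj) thetaS.
move=> /(_ _ i j); rewrite !permE => -> // x y; rewrite !permE cycle_walk_mx1_sym.
by rewrite !cycle_walk_mxE (_ : s - y - (s - x) = x - y) //; ring.
Qed.

Lemma cycle_proj_shift i j : E i j = E (i - j) 0.
Proof.
rewrite -(cycle_proj_refl 0) !sub0r -(cycle_proj_refl (- j)).
by rewrite !opprK addNr addrC.
Qed.

Lemma cycle_proj_even d : E (- d) 0 = E d 0.
Proof. by rewrite -(cycle_proj_refl 0) !sub0r opprK oppr0. Qed.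

Lemma cycle_proj_sym i j : E i j = E j i.
Proof. by rewrite cycle_proj_shift -cycle_proj_even opprB -cycle_proj_shift. Qed.

Lemma cycle_proj_real i j : E i j \is Num.real.
Proof.
have trCE (A : 'M[C]_n) a b : A^t* a b = (A b a)^* by rewrite !mxE.
apply/CrealP; rewrite -trCE eigenprojection_herm; last exact: cycle_walk_mx_herm.
exact: cycle_proj_sym.
Qed.

(** Expand [sum_k (E 0 k + s E d k)^2 >= 0] with [s = 1] and [s = -1], using that
    [E] is symmetric and idempotent. *)
Lemma cycle_proj_norm_le d : `|E d 0| <= E 0 0.
Proof.
have EE i j : E i j = \sum_k E i k * E j k.
  rewrite -{1}(eigenprojection_idem cycle_walk_mx_herm) mxE.
  by apply: eq_bigr => k _; rewrite (cycle_proj_sym k).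
have key (s : C) : s \is Num.real -> s ^+ 2 = 1 -> 0 <= E 0 0 + s * E d 0.
  move=> sr s1; have : 0 <= \sum_k (E 0 k + s * E d k) ^+ 2.
    apply: sumr_ge0 => k _; rewrite real_exprn_even_ge0 // realD ?realM //;
    exact: cycle_proj_real.
  rewrite (eq_bigr (fun k => E 0 k * E 0 k + E d k * E d k
     + (2%:R * s) * (E d k * E 0 k))) => [|k _]; last first.
    rewrite sqrrD exprMn s1 mul1r !expr2; ring.
  rewrite !big_split /= -mulr_sumr -!EE (cycle_proj_shift d d) subrr.
  rewrite (_ : _ + _ = 2%:R * (E 0 0 + s * E d 0)) ?pmulr_rge0 ?ltr0n //.
  by ring.
rewrite real_ler_norml ?cycle_proj_real //; apply/andP; split.
  by rewrite -subr_ge0 opprK addrC -[E d 0]mul1r key ?expr1n // real1.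
by rewrite -subr_ge0 -mulN1r key ?sqrrN ?expr1n // realN real1.
Qed.

(** The double-angle formula [cos^2 x = (1 + cos 2x) / 2]. *)
Lemma cycle_proj_double d :
  E d 0 ^+ 2 = E 0 0 * ((E 0 0 + E (d + d) 0) / 2%:R).
Proof.
have [c cE] := vertex_walk_mx_eigen sg d
  (eigenprojection_mull cycle_walk_mx_herm theta).
have cf a : c * E a 0 = (E (a - d) 0 + E (a + d) 0) / 2%:R.
  have /matrixP/(_ a 0) := cE.
  by rewrite cycle_walk_mulmx [RHS]mxE natr_Zp => <-.
have c0 : c * E 0 0 = E d 0.
  by rewrite cf sub0r add0r cycle_proj_even; field.
by rewrite expr2 -{1}c0 mulrAC cf subrr mulrC.
Qed.

Lemma cycle_proj_norm_leif d :
  (E 0 0 + E (d + d) 0) / 2%:R <= `|E d 0| ?= iff (E (d *+ 4) 0 == E 0 0).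
Proof.
apply: (@doubling_norm_ge _ _ _ (E (d + d) 0)); rewrite ?cycle_proj_norm_le //.
- exact: cycle_proj_real.
- exact: cycle_proj_double.
by rewrite cycle_proj_double -!mulr2n -mulrnA.
Qed.

End Projection.

Local Notation E := (eigenprojection (B 1)).
Local Notation S := (spectrum (B 1)).

Lemma sum_cycle_proj i j : \sum_(theta <- S) E theta i j = (i == j)%:R.
Proof.
by rewrite -summxE sum_eigenprojection ?mxE //; apply: cycle_walk_mx_herm.
Qed.

Lemma sum_cycle_proj_norm_leif d : d + d != 0 ->
  2%:R^-1 <= \sum_(theta <- S) `|E theta d 0| ?= iff (d *+ 4 == 0).
Proof.
move=> dd0.
have <- : \sum_(theta <- S) (E theta 0 0 + E theta (d + d) 0) / 2%:R = 2%:R^-1.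
  rewrite -mulr_suml big_split /= !sum_cycle_proj eqxx (negPf dd0).
  by rewrite addr0 mul1r.
have le th : th \in S -> 0 <= `|E th d 0| - (E th 0 0 + E th (d + d) 0) / 2%:R.
  by move=> thS; rewrite subr_ge0 (cycle_proj_norm_leif thS d).
split.
  by rewrite big_seq [leRHS]big_seq; apply: ler_sum => th /le; rewrite subr_ge0.
rewrite eq_sym -subr_eq0 -sumrB big_seq psumr_eq0 //.
have E4 th : th \in S ->
    (`|E th d 0| - (E th 0 0 + E th (d + d) 0) / 2%:R == 0) =
    (E th (d *+ 4) 0 == E th 0 0).
  move=> thS; rewrite subr_eq0 eq_sym.
  by rewrite (eq_leif (cycle_proj_norm_leif thS d)).
apply/allP/eqP => [E0|d4 th thS]; last by rewrite thS E4 // d4 eqxx.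
have : \sum_(th <- S) E th (d *+ 4) 0 = \sum_(th <- S) E th 0 0.
  rewrite big_seq [RHS]big_seq; apply: eq_bigr => th thS; apply/eqP.
  by rewrite -E4 //; have := E0 th thS; rewrite thS.
by rewrite !sum_cycle_proj eqxx => /eqP; rewrite eqr_nat eqb1 => /eqP.
Qed.

(** The two indicator functions in [cycle_walk_mxE] are disjoint when
    [i - j + (i - j) != 0]; the value is then 0 or 1/2, whatever [t] is. *)
Lemma cycle_walk_normE t i j : i - j + (i - j) != 0 ->
  `|B t i j| = if (i - j == t%:R) || (i - j == - t%:R) then 2%:R^-1 else 0.
Proof.
move=> dd0; rewrite cycle_walk_mxE.
have [dt|_] := eqVneq (i - j) t%:R; last first.
  by rewrite add0r orFb normrM normfV !normr_nat; case: eqP; rewrite ?mul1r ?mul0r.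
have [dt'|_] /= := eqVneq (i - j) (- t%:R).
  by move: dd0; rewrite {1}dt dt' subrr eqxx.
by rewrite addr0 mul1r normfV normr_nat.
Qed.

Lemma cycle_peak_quarter i j l : i - j + (i - j) != 0 ->
    (i - j) *+ 4 = 0 -> (0 < l)%N -> (i - j == l%:R) || (i - j == - l%:R) ->
  peak_state_transfer C Cn i j l.
Proof.
move=> dd0 d4 l0 dl.
have ij : i != j by apply: contraNneq dd0 => ->; rewrite subrr addr0.
have sumE : \sum_(theta <- S) `|E theta i j| = 2%:R^-1.
  rewrite big_seq (eq_bigr (fun th => `|E th (i - j) 0|)) => [|th thS].
    rewrite -big_seq; apply/esym/eqP.
    by rewrite (eq_leif (sum_cycle_proj_norm_leif dd0)) d4.
  by rewrite cycle_proj_shift.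
split=> //; first by rewrite cycle_walk_normE // dl sumE.
have : has (fun th => E th i j != 0) S.
  apply: contraT => /hasPn E0; move: sumE; rewrite big_seq big1 => [/esym/eqP|th].
    by rewrite invr_eq0 pnatr_eq0.
  by move=> /E0; rewrite negbK => /eqP->; rewrite normr0.
by move=> /hasP[th thS Eth]; exists th.
Qed.

(** Peak state transfer only links vertices whose difference has order dividing
    4 in Z/n. *)
Lemma cycle_peak_order i j t : peak_state_transfer C Cn i j t ->
  i - j + (i - j) = 0 \/ (i - j) *+ 4 = 0.
Proof.
case=> _ _ BE _; have [|dd0] := eqVneq (i - j + (i - j)) 0; [by left | right].
apply/eqP; rewrite -(eq_leif (sum_cycle_proj_norm_leif dd0)) eq_le.
rewrite (sum_cycle_proj_norm_leif dd0) /=.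
have <- : `|B t i j| = \sum_(theta <- S) `|E theta (i - j) 0|.
  rewrite BE big_seq [RHS]big_seq; apply: eq_bigr => th thS.
  by rewrite cycle_proj_shift.
by rewrite cycle_walk_normE //; case: ifP; rewrite ?lexx // invr_ge0 ler0n.
Qed.

Lemma cycle_natr_eq0 t : (t%:R == 0 :> V) = (n %| t)%N.
Proof. by rewrite -val_eqE /= (@val_Zp_nat n isT t). Qed.

Lemma cycle_periodic i : periodic_at C Cn n i.
Proof.
have nV : n%:R = 0 :> V by apply/eqP; rewrite cycle_natr_eq0 // dvdnn.
split=> //.
  apply: maps_stateP => //; rewrite cycle_walk_mxE subrr nV oppr0 eqxx.
  by rewrite -[1%:R + _]/(2%:R) divff // pnatr_eq0.
move=> s s0 /(maps_state_norm sg); rewrite cycle_walk_mxE subrr.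
rewrite [0 == - _]eq_sym oppr_eq0 [0 == _]eq_sym cycle_natr_eq0 //.
case: (boolP (n %| s)%N) => [/(dvdn_leq s0) //|_].
by rewrite addr0 mul0r normr0 => /esym/eqP; rewrite oner_eq0.
Qed.

Lemma cycle_perfect i j m : i != j -> j - i = m%:R -> j - i + (j - i) = 0 ->
  perfect_state_transfer C Cn i j m.
Proof.
move=> ij dm dd0; split=> //; apply: maps_stateP => //.
rewrite cycle_walk_mxE -dm eqxx -[_ == - _]subr_eq0 opprK dd0 eqxx.
by rewrite -[1%:R + _]/(2%:R) divff // pnatr_eq0.
Qed.

End Cycle.

Theorem lemma4p2 (R : realType) (n : nat) (hn : (3 <= n)%N) :
  let C := complex R in
  let Cn := @cycle_adj n in
  [/\ forall i : 'I_n, periodic_at C Cn n i,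
      forall m : nat, n = (2 * m)%N ->
        forall i j : 'I_n, j = i + m %[mod n] ->
          perfect_state_transfer C Cn i j m,
      forall l : nat, n = (4 * l)%N ->
        forall i j : 'I_n, j = i + l %[mod n] \/ i = j + l %[mod n] ->
          peak_state_transfer C Cn i j l
    & forall (i j : 'I_n) (t : nat), peak_state_transfer C Cn i j t ->
        (exists2 m : nat, n = (2 * m)%N & j = i + m %[mod n]) \/
        (exists2 l : nat, n = (4 * l)%N &
           j = i + l %[mod n] \/ i = j + l %[mod n])].
Proof.
case: n hn => [|[|[|p]]] //= _; set n := p.+3.
have modE (i j : 'I_n) t : (j = i + t %[mod n])%N <-> j - i = t%:R.
  rewrite (modn_small (ltn_ord j)); split=> [jit|/eqP].
    apply/eqP; rewrite subr_eq addrC -val_eqE /= (@val_Zp_nat n isT t).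
    by rewrite modnDmr jit.
  by rewrite subr_eq addrC -val_eqE /= (@val_Zp_nat n isT t) modnDmr => /eqP.
have natE t : (t%:R == 0 :> 'I_n) = (n %| t)%N by rewrite cycle_natr_eq0.
split; first exact: cycle_periodic.
- move=> m nm i j /modE jim; apply: cycle_perfect => //.
    apply: contraTneq isT => ij; move: jim; rewrite ij subrr => /esym/eqP.
    rewrite natE => /dvdn_leq; lia.
  by apply/eqP; rewrite jim -natrD natE addnn -mul2n -nm dvdnn.
- move=> l nl i j ijl.
  have dl : (i - j == l%:R) || (i - j == - l%:R).
    case: ijl => /modE ijl; last by rewrite ijl eqxx.
    by rewrite -(opprB j i) ijl eqxx orbT.
  have l0 : (0 < l)%N by lia.
  have natd q : ((i - j) *+ q == 0) = (n %| q * l)%N.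
    rewrite -natE mulnC; case/orP: dl => /eqP->.
      by rewrite mulrnA.
    by rewrite mulNrn oppr_eq0 mulrnA.
  apply: cycle_peak_quarter => //.
  - by rewrite -mulr2n natd nl gtnNdvd ?ltn_pmul2r ?muln_gt0.
  - by apply/eqP; rewrite natd -nl dvdnn.
move=> i j t peak; have [ij _ _ _] := peak.
pose k := val (i - j); have dk : i - j = k%:R by rewrite natr_Zp.
have kn : (k < n)%N by apply: ltn_ord.
have k0 : (0 < k)%N.
  rewrite lt0n; apply: contraNneq ij => k0; move/eqP: dk.
  by rewrite k0 subr_eq0.
have half : (n = 2 * k)%N -> exists2 m : nat, n = (2 * m)%N & j = i + m %[mod n].
  move=> nk; exists k => //; apply/modE/eqP; rewrite -opprB dk -subr_eq0.
  by rewrite -opprD oppr_eq0 -natrD natE addnn -mul2n -nk dvdnn.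
case: (cycle_peak_order peak) => /eqP; rewrite dk.
  rewrite -natrD natE => /dvdnP[q kq]; left; apply: half.
  have : (0 < q < 2)%N by nia.
  by case: q kq => [|[|]] //; lia.
(* 4k = qn with 0 < k < n leaves q = 1, 2, 3, that is k = n/4, n/2 or 3n/4. *)
rewrite -mulrnA natE => /dvdnP[q kq].
have : (0 < q < 4)%N by nia.
case: q kq => [|[|[|[|]]]] // kq _.
- by right; exists k; [lia | right; apply/modE].
- by left; apply: half; lia.
right; exists (n - k)%N; first lia.
left; apply/modE; rewrite -opprB dk natrB ?(ltnW kn) //.
by rewrite (_ : n%:R = 0) ?sub0r //; apply/eqP; rewrite natE dvdnn.
Qed.
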